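(* Let $F$ be an algebraically closed field of characteristic zero. Each of the Lie algebras $\mathfrak{sl}_\infty(F)$ (special), $\mathfrak{o}_\infty(F)$ (orthogonal) and $\mathfrak{sp}_\infty(F)$ (symplectic) admits a 3-grading $L = L_{-1}\oplus L_0\oplus L_1$ such that $L_0 = [L_{-1}, L_1]$.
   Context: $\mathbb{M}_\infty(F)=\bigcup_{n\ge 1}\mathbb{M}_n(F)$ is the algebra of infinite matrices (rows and columns indexed by the positive integers) with finitely many nonzero entries, and $\mathfrak{gl}_\infty(F)=\mathbb{M}_\infty(F)^-$ is the Lie algebra with bracket $[a,b]=ab-ba$. Let $y$ be the infinite block diagonal matrix all of whose diagonal blocks are $\begin{pmatrix}0&1\\-1&0\end{pmatrix}$. Then $$\mathfrak{sl}_\infty(F)=\{x\in\mathfrak{gl}_\infty(F)\mid \mathrm{tr}(x)=0\},$$ $$\mathfrak{o}_\infty(F)=\{x\in\mathfrak{gl}_\infty(F)\mid x^t+x=0\},$$ $$\mathfrak{sp}_\infty(F)=\{x\in\mathfrak{gl}_\infty(F)\mid x^ty+yx=0\}.$$ A 3-grading of a Lie algebra $L$ is a decomposition into subspaces $L=L_{-1}\oplus L_0\oplus L_1$ with $[L_i,L_j]\subseteq L_{i+j}$ (where $L_m=0$ for $|m|>1$). $[L_{-1},L_1]$ denotes the span of the brackets. *)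

(* Defs.v *)
From mathcomp Require Import all_boot all_order all_algebra finmap.
From mathcomp Require Import mathcomp_extra boolp classical_sets functions.
From mathcomp Require Import cardinality fsbigop.

Set Implicit Arguments.
Unset Strict Implicit.
Unset Printing Implicit Defensive.

Import GRing.Theory.

Local Open Scope classical_set_scope.
Local Open Scope ring_scope.

Section LieGradings.
Variables (R : pzRingType) (V : lmodType R).
Implicit Types (br : V -> V -> V) (A B L : set V).

Definition subspace A : Prop := GRing.submod_closed [in A].

Definition lspan A : set V := smallest subspace A.

Definition lie_product br A B : set V :=
  lspan [set z | exists a b, [/\ A a, B b & z = br a b]].

(* A 3-grading of the Lie algebra with carrier L, a subspace of V, and bracket
   br (only its values on L matter). The components are indexed by all of int,
   those outside {-1, 0, 1} being zero. *)
Definition three_grading br L (g : int -> set V) : Prop :=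
  [/\ forall i, subspace (g i),
      forall i, (1 < `|i|)%N -> g i = [set 0],
      (forall x, L x <->
         exists a b c, [/\ g (-1) a, g 0 b, g 1 c & x = a + b + c]),
      (forall a b c, g (-1) a -> g 0 b -> g 1 c ->
         a + b + c = 0 -> [/\ a = 0, b = 0 & c = 0])
    & forall i j a b, g i a -> g j b -> g (i + j) (br a b)].

End LieGradings.

Section InfiniteMatrices.
Variable F : fieldType.

(* Arbitrary infinite matrices over F, with 0-based indices; F^o makes them a
   vector space over F under the pointwise operations. *)
Definition infmx := nat -> nat -> F^o.

Implicit Types x y a b : infmx.

(* The sum defining an entry is the finitely supported one: it is the usual sum
   when finitely many terms are nonzero, as when a or b is in gl_inf, and 0
   otherwise. The same goes for the trace. *)
Definition mulinf a b : infmx :=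
  fun i j => \sum_(k \in [set: nat]) (a i k * b k j : F).

Definition trinf a : F := \sum_(k \in [set: nat]) (a k k : F).

Definition trinfmx a : infmx := fun i j => a j i.

Definition brinf a b : infmx := mulinf a b - mulinf b a.

Definition gl_inf : set infmx :=
  [set x | exists n : nat, forall i j, (n <= i)%N || (n <= j)%N -> x i j = 0].

(* Block diagonal, with all blocks [[0, 1], [-1, 0]]: the k-th block occupies
   the rows and columns 2k and 2k+1. *)
Definition sympl_inf : infmx := fun i j =>
  if ~~ odd i && (j == i.+1) then 1
  else if ~~ odd j && (i == j.+1) then -1 else 0.

Definition sl_inf : set infmx := [set x | gl_inf x /\ trinf x = 0].

Definition o_inf : set infmx := [set x | gl_inf x /\ trinfmx x + x = 0].

Definition sp_inf : set infmx :=
  [set x | gl_inf x /\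
     mulinf (trinfmx x) sympl_inf + mulinf sympl_inf x = 0].

Lemma fsum_natE (n : nat) (f : nat -> F) :
  (forall k, (n <= k)%N -> f k = 0) ->
  \sum_(k \in [set: nat]) f k = \sum_(k < n) f k.
Proof.
move=> f0; rewrite -(big_mkord xpredT f) (fsbigE (index_iota 0 n)) ?iota_uniq//.
  by apply: eq_bigl => k; rewrite in_setT.
by move=> k _; rewrite mem_index_iota -leqNgt => /f0.
Qed.

Lemma mulinfE (n : nat) a b i j :
  (forall k, (n <= k)%N -> a i k = 0) \/ (forall k, (n <= k)%N -> b k j = 0) ->
  mulinf a b i j = \sum_(k < n) (a i k * b k j : F).
Proof.
by case=> h; apply: fsum_natE => k /h ->; rewrite (mul0r, mulr0).
Qed.

Lemma trinfE (n : nat) a :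
  (forall k, (n <= k)%N -> a k k = 0) -> trinf a = \sum_(k < n) (a k k : F).
Proof. exact: fsum_natE. Qed.

End InfiniteMatrices.

Arguments gl_inf : clear implicits.
Arguments sl_inf : clear implicits.
Arguments o_inf : clear implicits.
Arguments sp_inf : clear implicits.
Arguments sympl_inf : clear implicits.

(* Main.v *)
Require Import Defs.
From mathcomp Require Import all_boot all_order all_algebra.
From mathcomp Require Import boolp classical_sets functions cardinality fsbigop.
From HB Require Import structures.
From mathcomp Require Import ring.

(** All three gradings come from a derivation D of the algebra L, namely
    bracketing with a fixed (possibly infinite) matrix h, such that
    D^3 = D on L. In characteristic 0 the polynomial X^3 - X has the simple
    roots -1, 0, 1, so L is the direct sum of the eigenspaces of D for -1, 0
    and 1, and the Leibniz rule makes this decomposition a grading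
    ([three_grading_eigen]). As [L_{-1}, L_1] always lies in L_0, what remains
    in each case is to write the elements of L_0 as combinations of brackets
    ([gl_eigen_grading] collects all this for subalgebras of gl_inf).

    - sl_inf: h is the matrix unit e_00. An element of L_0 is the sum of its
      entries times e_ij - delta_ij e_00, the correction by e_00 summing to
      zero with the trace, and for i, j > 0 this is [e_i0, e_0j]
      ([sl_graded]).

    - o_inf and sp_inf are the elements of gl_inf that a linear
      antiautomorphism tau (the transpose, or the adjoint for the symplectic
      form) maps to their opposites. Averaging the expansion of x into matrix
      units with its image under - tau writes x as a combination of the
      e_ij - tau e_ij for which x_ij <> 0, so that only these have to be
      obtained from brackets ([skew_span]).

    - sp_inf: h is the diagonal idempotent on the odd indices, and the grading
      is by the blocks of the two Lagrangian subspaces of even and odd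
      indices. Then L_{-1} and L_1 are symmetric matrices and L_0 is a copy of
      gl_inf; for i, j even, with i', j' their symplectic partners,
      [e_ij' + e_ji', e_j'j] is e_ij - e_j'i' up to the factor 1 or 2
      ([sp_even_bracket]).

    - o_inf: h is the square root im of -1 times the infinitesimal rotation
      e_01 - e_10 in the plane of the indices 0 and 1. The vectors e_0 + im e_1
      and e_0 - im e_1 are isotropic eigenvectors of h, and L_{-1}, L_1 consist
      of the wedge products of these vectors with the other basis vectors. The
      brackets of such products give e_0 /\ e_1 and all e_i /\ e_j with
      i, j > 1, that is, a spanning set of L_0 ([isotropic_wedge_bracket],
      [lie_product_wedge]). *)

Set Implicit Arguments.
Unset Strict Implicit.
Unset Printing Implicit Defensive.

Import GRing.Theory.

Local Open Scope classical_set_scope.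
Local Open Scope ring_scope.

(** * Subspaces and spans *)

Section Subspaces.
Variables (R : pzRingType) (V : lmodType R).
Implicit Types (A S : set V).

Lemma subspaceP A :
  subspace A <-> A 0 /\ forall k u v, A u -> A v -> A (k *: u + v).
Proof.
split=> [[A0 Alin]|[A0 Alin]]; split.
- by have := A0; rewrite inE.
- by move=> k u v Au Av; have := Alin k u v; rewrite !inE; apply.
- by rewrite inE.
- by move=> k u v; rewrite !inE; apply: Alin.
Qed.

Lemma subspaceD A u v : subspace A -> A u -> A v -> A (u + v).
Proof. by move=> /subspaceP[_ Al] Au Av; rewrite -[u]scale1r; apply: Al. Qed.

Lemma subspaceZ A k u : subspace A -> A u -> A (k *: u).
Proof. by move=> /subspaceP[A0 Al] Au; rewrite -[_ *: _]addr0; apply: Al. Qed.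

Lemma subspaceB A u v : subspace A -> A u -> A v -> A (u - v).
Proof.
move=> sA Au Av; apply: subspaceD => //.
by rewrite -scaleN1r; apply: subspaceZ.
Qed.

Lemma subspace_sum A (I : Type) (r : seq I) (u : I -> V) :
  subspace A -> (forall i, A (u i)) -> A (\sum_(i <- r) u i).
Proof.
move=> sA Au; apply: (big_ind A) => // [|v w]; first by case/subspaceP: sA.
exact: subspaceD.
Qed.

Lemma subspace_lspan A : subspace (lspan A).
Proof.
apply/subspaceP; split=> [S [/subspaceP[]]//|k u v Au Av S [sS AS]].
by case/subspaceP: (sS) => _; apply; [apply: Au|apply: Av].
Qed.

Lemma lie_product_br (br : V -> V -> V) A S a b :
  A a -> S b -> lie_product br A S (br a b).
Proof. by move=> Aa Sb T [_]; apply; exists a, b. Qed.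

End Subspaces.

Lemma pchar0_intr_eq0 (F : fieldType) (m : int) :
  [pchar F] =i pred0 -> ((m%:~R : F) == 0) = (m == 0).
Proof.
move=> /GRing.pcharf0P F0; case: m => n; first by rewrite -pmulrn F0.
by rewrite NegzE mulrNz oppr_eq0 -pmulrn F0.
Qed.

(** * Gradings by eigenspaces of a derivation *)

Section GradingFromDerivation.
Variables (F : fieldType) (V : lmodType F) (br : V -> V -> V) (L : set V).
Variable D : {linear V -> V}.

Definition eigengrading (i : int) : set V := L `&` [set x | D x = i%:~R *: x].

Hypothesis charF : [pchar F] =i pred0.
Hypothesis subL : subspace L.
Hypothesis brL : forall a b, L a -> L b -> L (br a b).
Hypothesis brZl : forall k a b, L a -> L b -> br (k *: a) b = k *: br a b.
Hypothesis brZr : forall k a b, L a -> L b -> br a (k *: b) = k *: br a b.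
Hypothesis DL : forall x, L x -> L (D x).
Hypothesis D_br :
  forall a b, L a -> L b -> D (br a b) = br (D a) b + br a (D b).
Hypothesis D3 : forall x, L x -> D (D (D x)) = D x.

Lemma eigengradingN1 x : L x -> D x = - x -> eigengrading (-1) x.
Proof. by move=> Lx Dx; split=> //=; rewrite mulrN1z scaleN1r. Qed.

Lemma eigengrading1 x : L x -> D x = x -> eigengrading 1 x.
Proof. by move=> Lx Dx; split=> //=; rewrite scale1r. Qed.

Lemma eigengrading0 x : L x -> D x = 0 -> eigengrading 0 x.
Proof. by move=> Lx Dx; split=> //=; rewrite scale0r. Qed.

(** The projections of x to the eigenspaces for -1, 0 and 1 are the values at x
    of the interpolation polynomials (D^2 - D)/2, 1 - D^2 and (D^2 + D)/2. *)
Lemma three_grading_eigen : three_grading br L eigengrading.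
Proof.
have two0 : (2%:R : F) != 0 by have /GRing.pcharf0P -> := charF.
split.
- move=> i; apply/subspaceP; split.
    by split=> /=; [case/subspaceP: subL|rewrite linear0 scaler0].
  move=> k u v [Lu Du] [Lv Dv]; split=> /=.
    by case/subspaceP: subL => _; apply.
  by rewrite linearP /= Du Dv scalerDr !scalerA mulrC.
(* An eigenvector for i satisfies (i^3 - i) x = 0 as D^3 = D. *)
- move=> i i1; apply/seteqP; split=> x /=; last first.
    by move=> ->; split=> /=; [case/subspaceP: subL|rewrite linear0 scaler0].
  move=> [Lx /= Dx]; have := D3 Lx.
  have DZ k u : D (k *: u) = k *: D u by exact: linearZ_LR.
  rewrite Dx DZ Dx DZ DZ Dx => /eqP; rewrite -subr_eq0 !scalerA -scalerBl.
  rewrite -!intrM -intrB scaler_eq0 pchar0_intr_eq0 //.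
  have -> : i * i * i - i = i * ((i - 1) * (i + 1)) by ring.
  rewrite !mulf_eq0 subr_eq0 addr_eq0 => /orP[|/eqP//].
  by case/or3P => /eqP i_; rewrite i_ in i1.
- move=> x; split=> [Lx|[a [b [c [[La _] [Lb _] [Lc _] ->]]]]]; last first.
    by do 2!apply: subspaceD => //.
  exists (2%:R^-1 *: (D (D x) - D x)), (x - D (D x)).
  exists (2%:R^-1 *: (D (D x) + D x)); split.
  + apply: eigengradingN1.
      by apply: subspaceZ => //; apply: subspaceB; do ?apply: DL.
    by rewrite linearZ_LR linearB /= D3 // -scalerN opprB.
  + apply: eigengrading0; first by apply: subspaceB; do ?apply: DL.
    by rewrite linearB /= D3 // subrr.
  + apply: eigengrading1.
      by apply: subspaceZ => //; apply: subspaceD; do ?apply: DL.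
    by rewrite linearZ_LR linearD /= D3 // addrC.
  + rewrite addrAC -scalerDr addrACA addNr addr0 -mulr2n -scaler_nat scalerA.
    by rewrite mulVf // scale1r addrC subrK.
- move=> a b c [_ /= Da] [_ /= Db] [_ /= Dc] abc0.
  rewrite mulrN1z scaleN1r in Da; rewrite scale0r in Db; rewrite scale1r in Dc.
  have ca : c = a.
    apply/eqP; rewrite -subr_eq0 addrC; apply/eqP.
    by have := congr1 D abc0; rewrite linear0 !linearD /= Da Db Dc addr0.
  have a0 : a = 0.
    have := Dc; rewrite ca Da => /eqP.
    rewrite eq_sym -addr_eq0 -mulr2n -scaler_nat.
    by rewrite scaler_eq0 (negbTE two0) /= => /eqP.
  by move: abc0; rewrite ca a0 add0r addr0 => ->.
- move=> i j a b [La /= Da] [Lb /= Db]; split=> /=; first exact: brL.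
  by rewrite D_br // Da Db brZl // brZr // -scalerDl -intrD.
Qed.

Lemma lie_product_sub_eigen0 :
  lie_product br (eigengrading (-1)) (eigengrading 1) `<=` eigengrading 0.
Proof.
have [sg _ _ _ grbr] := three_grading_eigen.
apply: smallest_sub; first exact: sg.
by move=> _ [a [b [ga gb ->]]]; apply: (grbr (-1) 1).
Qed.

End GradingFromDerivation.

(** * The Lie algebra of finitely supported matrices *)

Section FiniteSupport.
Variable F : fieldType.
Implicit Types (a b c x : infmx F).

Lemma gl_subspace : subspace (gl_inf F).
Proof.
apply/subspaceP; split=> [|k u v [n un] [m vm]]; first by exists 0%N.
exists (maxn n m) => i j; rewrite !geq_max => ij.
change (k * u i j + v i j = 0).
by case/orP: ij => /andP[nl ml]; rewrite un ?vm ?mulr0 ?addr0 ?nl ?ml ?orbT.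
Qed.

Lemma gl_common a b : gl_inf F a -> gl_inf F b ->
  exists n, (forall i j, (n <= i)%N || (n <= j)%N -> a i j = 0) /\
            (forall i j, (n <= i)%N || (n <= j)%N -> b i j = 0).
Proof.
move=> [n an] [m bm]; exists (maxn n m).
by split=> i j; rewrite !geq_max => /orP[] /andP[nl ml];
  rewrite ?an ?bm ?nl ?ml ?orbT.
Qed.

Lemma mulinf_gl a b : gl_inf F a -> gl_inf F b -> gl_inf F (mulinf a b).
Proof.
move=> ga gb; have [n [an bn]] := gl_common ga gb.
exists n => i j ij; rewrite (@mulinfE _ n); last first.
  by left=> k nk; rewrite an ?nk ?orbT.
apply: big1 => k _; case/orP: ij => [ni|nj].
  by rewrite an ?ni // mul0r.
by rewrite bn ?nj ?orbT // mulr0.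
Qed.

Lemma brinf_gl a b : gl_inf F a -> gl_inf F b -> gl_inf F (brinf a b).
Proof. by move=> ga gb; apply: (subspaceB gl_subspace); apply: mulinf_gl. Qed.

Lemma mulinf_linearr a : gl_inf F a -> linear (mulinf a).
Proof.
move=> [n an] k u v; apply/funext => i; apply/funext => j.
change (mulinf a (k *: u + v) i j = k * mulinf a u i j + mulinf a v i j).
have {}an l : (n <= l)%N -> a i l = 0 by move=> nl; rewrite an ?nl ?orbT.
rewrite !(@mulinfE _ n); try by left.
rewrite mulr_sumr -big_split; apply: eq_bigr => l _ /=.
change (a i l * (k * u l j + v l j) = k * (a i l * u l j) + a i l * v l j :> F).
by ring.
Qed.

Lemma mulinf_linearl a : gl_inf F a -> linear (fun x => mulinf x a).
Proof.
move=> [n an] k u v; apply/funext => i; apply/funext => j.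
change (mulinf (k *: u + v) a i j = k * mulinf u a i j + mulinf v a i j).
have {}an l : (n <= l)%N -> a l j = 0 by move=> nl; rewrite an ?nl.
rewrite !(@mulinfE _ n); try by right.
rewrite mulr_sumr -big_split; apply: eq_bigr => l _ /=.
change ((k * u i l + v i l) * a l j = k * (u i l * a l j) + v i l * a l j :> F).
by ring.
Qed.

Lemma brinf_linear a : gl_inf F a -> linear (brinf a).
Proof.
move=> ga k u v; rewrite /brinf mulinf_linearr // (mulinf_linearl ga).
by rewrite scalerBr opprD addrACA.
Qed.

Lemma brinfC a b : brinf a b = - brinf b a.
Proof. by rewrite /brinf opprB. Qed.

Lemma brinfZr (k : F) a b : gl_inf F a -> brinf a (k *: b) = k *: brinf a b.
Proof.
by move=> ga; apply: (GRing.scalable_linear (brinf_linear ga)).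
Qed.

Lemma mulinfA a b c : gl_inf F a -> gl_inf F c ->
  mulinf a (mulinf b c) = mulinf (mulinf a b) c.
Proof.
move=> ga gc; have [n [an cn]] := gl_common ga gc.
have {}an i l : (n <= l)%N -> a i l = 0 by move=> nl; rewrite an ?nl ?orbT.
have {}cn l j : (n <= l)%N -> c l j = 0 by move=> nl; rewrite cn ?nl.
apply/funext => i; apply/funext => j.
rewrite (@mulinfE _ n); last by left; apply: an.
rewrite [RHS](@mulinfE _ n); last by right => l; apply: cn.
under eq_bigr => l _.
  rewrite (@mulinfE _ n) ?mulr_sumr; last by right => m; apply: cn.
  over.
rewrite exchange_big; apply: eq_bigr => l _.
rewrite (@mulinfE _ n); last by left => m; apply: an.
by rewrite mulr_suml; apply: eq_bigr => m _; rewrite mulrA.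
Qed.

(** Jacobi's identity, in the form that bracketing with h obeys the Leibniz
    rule. *)
Lemma brinf_derivation h a b : gl_inf F h -> gl_inf F a -> gl_inf F b ->
  brinf h (brinf a b) = brinf (brinf h a) b + brinf a (brinf h b).
Proof.
move=> gh ga gb.
have mulBr c u v : gl_inf F c -> mulinf c (u - v) = mulinf c u - mulinf c v.
  by move=> gc; apply: (GRing.zmod_morphism_linear (mulinf_linearr gc)).
have mulBl c u v : gl_inf F c -> mulinf (u - v) c = mulinf u c - mulinf v c.
  by move=> gc; apply: (GRing.zmod_morphism_linear (mulinf_linearl gc)).
rewrite /brinf !mulBr ?mulBl // !mulinfA //.
apply/funext => i; apply/funext => j.
set hab := mulinf (mulinf h a) b; set hba := mulinf (mulinf h b) a.
set abh := mulinf (mulinf a b) h; set bah := mulinf (mulinf b a) h.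
set ahb := mulinf (mulinf a h) b; set bha := mulinf (mulinf b h) a.
change (hab i j - hba i j - (abh i j - bah i j) =
  hab i j - ahb i j - (bha i j - bah i j) +
  (ahb i j - abh i j - (hba i j - bha i j)) :> F).
by ring.
Qed.

Lemma trinf_linear (k : F) a b : gl_inf F a -> gl_inf F b ->
  trinf (k *: a + b) = k * trinf a + trinf b.
Proof.
move=> ga gb; have [n [an bn]] := gl_common ga gb.
rewrite !(@trinfE _ n).
- by rewrite mulr_sumr -big_split.
- by move=> i ni; rewrite bn ?ni.
- by move=> i ni; rewrite an ?ni.
- move=> i ni; change (k * a i i + b i i = 0).
  by rewrite an ?bn ?ni // mulr0 addr0.
Qed.

Lemma trinf_mulC a b : gl_inf F a -> gl_inf F b ->
  trinf (mulinf a b) = trinf (mulinf b a).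
Proof.
move=> ga gb; have [n [an bn]] := gl_common ga gb.
have tr c d : (forall i j, (n <= i)%N || (n <= j)%N -> c i j = 0) ->
    trinf (mulinf c d) = \sum_(i < n) \sum_(j < n) (c i j * d j i : F).
  move=> cn; have mE i : mulinf c d i i = \sum_(j < n) (c i j * d j i : F).
    by rewrite (@mulinfE _ n) //; left => j nj; rewrite cn ?nj ?orbT.
  rewrite (@trinfE _ n) => [|i ni]; first by apply: eq_bigr => i _; apply: mE.
  by rewrite mE big1 // => j _; rewrite cn ?ni // mul0r.
rewrite !tr // exchange_big.
by apply: eq_bigr => i _; apply: eq_bigr => j _; rewrite mulrC.
Qed.

Lemma trinf_brinf a b : gl_inf F a -> gl_inf F b -> trinf (brinf a b) = 0.
Proof.
move=> ga gb; rewrite /brinf -scaleN1r addrC trinf_linear; try exact: mulinf_gl.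
by rewrite mulN1r trinf_mulC // addNr.
Qed.

Definition munit (i j : nat) : infmx F := fun k l => ((k == i) && (l == j))%:R.

Lemma munit_gl i j : gl_inf F (munit i j).
Proof.
exists (maxn i j).+1 => k l; rewrite /munit.
case: eqP => [->|_]; case: eqP => [->|_] //.
by rewrite !ltnNge leq_maxl leq_maxr.
Qed.

Lemma fsum_single (f : nat -> F) m : (forall k, k != m -> f k = 0) ->
  \sum_(k \in [set: nat]) f k = f m.
Proof.
move=> f0; rewrite (@fsum_natE _ m.+1) => [|k mk]; last first.
  by rewrite f0 // gtn_eqF.
by rewrite big_ord_recr /= big1 ?add0r // => k _; rewrite f0 // ltn_eqF.
Qed.

Lemma mul_munitl i j a k l : mulinf (munit i j) a k l = (k == i)%:R * a j l.
Proof.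
rewrite /mulinf (@fsum_single _ j) => [|m mj]; rewrite /munit.
  by rewrite eqxx andbT.
by rewrite (negbTE mj) andbF mul0r.
Qed.

Lemma mul_munitr i j a k l : mulinf a (munit i j) k l = a k i * (l == j)%:R.
Proof.
rewrite /mulinf (@fsum_single _ i) => [|m mj]; rewrite /munit.
  by rewrite eqxx.
by rewrite (negbTE mj) mulr0.
Qed.

Lemma mul_munit i j k l : mulinf (munit i j) (munit k l) =
  (j == k)%:R *: munit i l.
Proof.
apply/funext => p; apply/funext => q; rewrite mul_munitl.
change ((p == i)%:R * ((j == k) && (q == l))%:R =
        (j == k)%:R * ((p == i) && (q == l))%:R :> F).
by rewrite -!mulnb !natrM mulrCA.
Qed.

Lemma sum_munit x n : (forall i j, (n <= i)%N || (n <= j)%N -> x i j = 0) ->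
  x = \sum_(i < n) \sum_(j < n) x i j *: munit i j.
Proof.
move=> xn; apply/funext => k; apply/funext => l.
rewrite !fct_sumE /=; under eq_bigr => i _ do rewrite !fct_sumE.
change (x k l = \sum_(i < n) \sum_(j < n) (x i j * munit i j k l : F)).
have [kn|kn] := ltnP k n; last first.
  rewrite xn ?kn // big1 // => i _; rewrite big1 // => j _.
  by rewrite /munit gtn_eqF ?mulr0 // (leq_trans _ kn).
have [ln|ln] := ltnP l n; last first.
  rewrite xn ?ln ?orbT // big1 // => i _; rewrite big1 // => j _.
  by rewrite /munit [l == j]gtn_eqF ?andbF ?mulr0 // (leq_trans _ ln).
rewrite (bigD1 (Ordinal kn)) //= (bigD1 (Ordinal ln)) //= /munit !eqxx mulr1.
rewrite !big1 ?addr0 // => [i ik|j jl].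
  rewrite -(inj_eq val_inj) eq_sym in ik.
  by rewrite big1 // => j _; rewrite (negbTE ik) mulr0.
by rewrite -(inj_eq val_inj) eq_sym in jl; rewrite (negbTE jl) mulr0.
Qed.

Lemma brinf_munit x k l p q : brinf x (munit k l) p q =
  x p k * (q == l)%:R - (p == k)%:R * x l q.
Proof. by rewrite -mul_munitl -mul_munitr. Qed.

Lemma trinf_munit i j : trinf (munit i j) = (i == j)%:R.
Proof.
rewrite /trinf (@fsum_single _ i) /munit ?eqxx // => k ki.
by rewrite (negbTE ki).
Qed.

End FiniteSupport.

(** * Skew elements for an antiautomorphism *)

Section SkewElements.
Variables (F : fieldType) (tau : {linear infmx F -> infmx F}).
Implicit Types (a b x : infmx F).

Definition skew : set (infmx F) := gl_inf F `&` [set x | tau x = - x].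

Hypothesis charF : [pchar F] =i pred0.
Hypothesis tau_mul : forall a b, tau (mulinf a b) = mulinf (tau b) (tau a).

Lemma skew_subspace : subspace skew.
Proof.
have [gl0 gll] := (subspaceP _).1 (gl_subspace F).
apply/subspaceP; split=> [|k u v [gu /= tu] [gv /= tv]].
  by split=> //=; rewrite linear0 oppr0.
split; first by apply: gll.
by rewrite /= linearP /= tu tv scalerN opprD.
Qed.

Lemma skew_brinf a b : skew a -> skew b -> skew (brinf a b).
Proof.
move=> [ga /= ta] [gb /= tb]; split; first exact: brinf_gl.
have mulNN u v : mulinf (- u) (- v) = mulinf u v.
  apply/funext => i; apply/funext => j; rewrite /mulinf.
  by apply: eq_fsbigr => k _; apply: mulrNN.
by rewrite /= [RHS]opprB linearB /= !tau_mul ta tb !mulNN.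
Qed.

(** As tau x = - x, twice x is x - tau x, and x |-> x - tau x is linear. *)
Lemma skew_span (S : set (infmx F)) x : subspace S -> skew x ->
  (forall i j, x i j != 0 -> S (munit F i j - tau (munit F i j))) -> S x.
Proof.
move=> sS [[n xn] /= tx] SE.
have two0 : (2%:R : F) != 0 by have /GRing.pcharf0P -> := charF.
have -> : x = 2%:R^-1 *: (x - tau x).
  by rewrite tx opprK -mulr2n -scaler_nat scalerA mulVf // scale1r.
have -> : x - tau x =
    \sum_(i < n) \sum_(j < n) x i j *: (munit F i j - tau (munit F i j)).
  rewrite {1 2}(sum_munit xn) linear_sum -sumrB; apply: eq_bigr => i _.
  rewrite linear_sum -sumrB; apply: eq_bigr => j _.
  by rewrite linearZ_LR scalerBr.
apply: subspaceZ => //; apply: subspace_sum => // i.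
apply: subspace_sum => // j.
have [->|x0] := eqVneq (x i j) 0; last exact/(subspaceZ _ sS)/SE.
by rewrite scale0r; case/subspaceP: sS.
Qed.

End SkewElements.

(** * Bracketing with a diagonal idempotent *)

Section DiagonalDerivation.
Variables (F : fieldType) (d : nat -> bool).
Implicit Types (a b x : infmx F).

(** This is the bracket with the diagonal matrix of diagonal d, which is in
    general not in gl_inf: entries are weighted instead of multiplied. *)
Definition diag_der x : infmx F := fun i j => ((d i)%:R - (d j)%:R) * x i j.

Lemma diag_der_linear : linear diag_der.
Proof.
move=> k u v; apply/funext => i; apply/funext => j.
change (((d i)%:R - (d j)%:R) * (k * u i j + v i j) =
  k * (((d i)%:R - (d j)%:R) * u i j) + ((d i)%:R - (d j)%:R) * v i j :> F).
by ring.
Qed.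

HB.instance Definition _ :=
  GRing.isLinear.Build F (infmx F) (infmx F) *:%R diag_der diag_der_linear.

Lemma diag_der_gl x : gl_inf F x -> gl_inf F (diag_der x).
Proof.
by move=> [n xn]; exists n => i j /xn; rewrite /diag_der => ->; rewrite mulr0.
Qed.

(** The weights d i - d j lie in {-1, 0, 1}. *)
Lemma diag_der3 x : diag_der (diag_der (diag_der x)) = diag_der x.
Proof.
apply/funext => i; apply/funext => j; rewrite /diag_der.
by case: (d i); case: (d j) => /=; ring.
Qed.

Lemma diag_der_eq0 x i j : diag_der x = 0 -> d i != d j -> x i j = 0.
Proof.
move=> /(congr1 (fun y : infmx F => y i j)) /eqP.
change (((d i)%:R - (d j)%:R) * x i j == 0 :> F -> d i != d j -> x i j = 0).
rewrite mulf_eq0 => /orP[|/eqP//].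
by case: (d i); case: (d j); rewrite //= ?subr0 ?sub0r ?oppr_eq0 oner_eq0.
Qed.

Lemma diag_der_munit i j : diag_der (munit F i j) =
  ((d i)%:R - (d j)%:R) *: munit F i j.
Proof.
apply/funext => p; apply/funext => q.
change (((d p)%:R - (d q)%:R) * ((p == i) && (q == j))%:R =
  ((d i)%:R - (d j)%:R) * ((p == i) && (q == j))%:R :> F).
by case: eqP => [->|_]; case: eqP => [->|_]; rewrite ?mulr0.
Qed.

Lemma diag_der_mulinf a b : gl_inf F a -> gl_inf F b ->
  diag_der (mulinf a b) = mulinf (diag_der a) b + mulinf a (diag_der b).
Proof.
move=> [n an] gb; apply/funext => i; apply/funext => j.
change (((d i)%:R - (d j)%:R) * mulinf a b i j =
  mulinf (diag_der a) b i j + mulinf a (diag_der b) i j).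
rewrite !(@mulinfE _ n);
  try by left => k nk; rewrite /diag_der an ?nk ?orbT ?mulr0.
rewrite mulr_sumr -big_split; apply: eq_bigr => k _ /=.
by rewrite /diag_der; ring.
Qed.

Lemma diag_der_brinf a b : gl_inf F a -> gl_inf F b ->
  diag_der (brinf a b) = brinf (diag_der a) b + brinf a (diag_der b).
Proof.
move=> ga gb.
rewrite /brinf linearB /= !diag_der_mulinf //.
by rewrite opprD [X in _ + X]addrC addrACA.
Qed.

End DiagonalDerivation.

(** * Gradings of subalgebras of gl_inf *)

(** The part of the construction common to the three algebras: after the
    choice of D, only the spanning of L_0 by brackets has to be proved. *)
Lemma gl_eigen_grading (F : fieldType) (charF : [pchar F] =i pred0)
    (L : set (infmx F)) (D : {linear infmx F -> infmx F}) :
  L `<=` gl_inf F -> subspace L ->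
  (forall a b, L a -> L b -> L (brinf a b)) ->
  (forall x, L x -> L (D x)) ->
  (forall a b, L a -> L b -> D (brinf a b) = brinf (D a) b + brinf a (D b)) ->
  (forall x, L x -> D (D (D x)) = D x) ->
  (forall x, L x -> D x = 0 -> lie_product (@brinf F)
     (eigengrading L D (-1)) (eigengrading L D 1) x) ->
  exists g : int -> set (infmx F),
    three_grading (@brinf F) L g /\
    g 0 = lie_product (@brinf F) (g (-1)) (g 1).
Proof.
move=> Lgl sL brL DL Dbr D3 span0.
have brZr k a b : L a -> L b -> brinf a (k *: b) = k *: brinf a b.
  by move=> /Lgl ga _; apply: brinfZr.
have brZl k a b : L a -> L b -> brinf (k *: a) b = k *: brinf a b.
  by move=> /Lgl ga /Lgl gb; rewrite brinfC brinfZr // -scalerN -brinfC.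
exists (eigengrading L D); split; first exact: three_grading_eigen.
apply/seteqP; split; last exact: lie_product_sub_eigen0.
by move=> x [Lx /= Dx]; apply: span0; rewrite // Dx scale0r.
Qed.

(** * The special linear algebra *)

Section SpecialLinear.
Variable F : fieldType.
Hypothesis charF : [pchar F] =i pred0.

Lemma sl_subspace : subspace (sl_inf F).
Proof.
have [gl0 gll] := (subspaceP _).1 (gl_subspace F).
apply/subspaceP; split=> [|k u v [gu tu] [gv tv]].
  by split=> //; rewrite (@trinfE _ 0) ?big_ord0.
split; first by apply: gll.
by rewrite trinf_linear // tu tv mulr0 addr0.
Qed.

Lemma sl_graded : exists g : int -> set (infmx F),
  three_grading (@brinf F) (sl_inf F) g /\
  g 0 = lie_product (@brinf F) (g (-1)) (g 1).
Proof.
pose d (i : nat) := i == 0%N.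
apply: (gl_eigen_grading charF (D := @diag_der F d)).
- by move=> x [].
- exact: sl_subspace.
- by move=> a b [ga _] [gb _]; split; [apply: brinf_gl|apply: trinf_brinf].
- move=> x [gx _]; split; first exact: diag_der_gl.
  rewrite (@trinfE _ 0) ?big_ord0 // => k _.
  by rewrite /= /diag_der subrr mul0r.
- by move=> a b [ga _] [gb _]; apply: diag_der_brinf.
- by move=> x _; apply: diag_der3.
set S := lie_product _ _ _.
have sS : subspace S by apply: subspace_lspan.
move=> x [[n xn] trx] Dx.
have xd i j := diag_der_eq0 (i := i) (j := j) Dx.
(* The corrections add up to tr(x) e_00 = 0. *)
have -> : x = \sum_(i < n) \sum_(j < n)
    x i j *: (munit F i j - (i == j :> nat)%:R *: munit F 0 0).
  under eq_bigr => i _ do under eq_bigr => j _ do rewrite scalerBr.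
  under eq_bigr => i _ do rewrite sumrB.
  rewrite sumrB -(sum_munit xn); apply/esym/subr0_eq.
  rewrite addrAC subrr sub0r.
  apply/eqP; rewrite oppr_eq0; apply/eqP.
  transitivity ((\sum_(i < n) (x i i : F)) *: munit F 0 0); last first.
    by rewrite -trinfE ?trx ?scale0r // => k nk; rewrite xn ?nk.
  rewrite scaler_suml; apply: eq_bigr => i _.
  rewrite (bigD1 i) //= eqxx scale1r big1 ?addr0 // => j ji.
  rewrite -(inj_eq val_inj) eq_sym in ji.
  by rewrite (negbTE ji) scale0r scaler0.
apply: (subspace_sum _ sS) => i; apply: (subspace_sum _ sS) => j.
have [i0|i0] := eqVneq (i : nat) 0%N; have [j0|j0] := eqVneq (j : nat) 0%N.
- by rewrite i0 j0 scale1r subrr scaler0; case/subspaceP: sS.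
- rewrite xd ?scale0r; first by case/subspaceP: sS.
  by rewrite /d i0 (negbTE j0).
- rewrite xd ?scale0r; first by case/subspaceP: sS.
  by rewrite /d j0 (negbTE i0).
apply: (subspaceZ _ sS).
have -> : munit F i j - (i == j :> nat)%:R *: munit F 0 0 =
    brinf (munit F i 0) (munit F 0 j).
  by rewrite /brinf !mul_munit scale1r [(j : nat) == i]eq_sym.
apply: lie_product_br.
- apply: eigengradingN1.
    by split; [apply: munit_gl|rewrite trinf_munit (negbTE i0)].
  by rewrite /= diag_der_munit /d (negbTE i0) sub0r scaleN1r.
- apply: eigengrading1.
    by split; [apply: munit_gl|rewrite trinf_munit eq_sym (negbTE j0)].
  by rewrite /= diag_der_munit /d (negbTE j0) subr0 scale1r.
Qed.

End SpecialLinear.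

(** * The symplectic algebra *)

Section Symplectic.
Variable F : fieldType.
Hypothesis charF : [pchar F] =i pred0.
Implicit Types (a b x : infmx F).

(** The index of the basis vector dual, up to sign, to e_i under the symplectic
    form. *)
Definition partner i := if odd i then i.-1 else i.+1.

Lemma odd_partner i : odd (partner i) = ~~ odd i.
Proof.
by rewrite /partner; case: i => //= i; case oi: (odd i); rewrite /= ?oi.
Qed.

Lemma partnerK : involutive partner.
Proof.
move=> i; rewrite {1}/partner odd_partner /partner.
by case: i => [//|i] /=; case: (odd i).
Qed.

Lemma eq_partner i j : (i == partner j) = (partner i == j).
Proof. by rewrite -(inj_eq (can_inj partnerK)) partnerK. Qed.

Definition sgnidx (i : nat) : F := (-1) ^+ odd i.

Lemma sgnidx_partner i : sgnidx (partner i) = - sgnidx i.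
Proof. by rewrite /sgnidx odd_partner signrN. Qed.

Lemma sgnidx_sqr i : sgnidx i * sgnidx i = 1.
Proof. by rewrite -expr2 sqrr_sign. Qed.

Lemma sympl_infE i j : sympl_inf F i j = sgnidx i * (j == partner i)%:R.
Proof.
rewrite /sympl_inf /sgnidx /partner; case: i => [|i] /=.
  by case: (j =P 1%N) => _; rewrite mul1r //= andbF.
case oi: (odd i) => /=.
  case: (j =P i.+2) => _; first by rewrite mul1r.
  by rewrite mulr0; case: (i.+1 =P j.+1) => [[<-]|_]; rewrite ?oi ?andbF.
rewrite eqSS eq_sym; case: (j =P i) => [->|_]; first by rewrite oi mulr1.
by rewrite andbF mulr0.
Qed.

(** The entries of y^-1 x^t y, where y is the matrix of the symplectic form. *)
Definition symplectic_adjoint x : infmx F :=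
  fun i j => sgnidx i * sgnidx j * x (partner j) (partner i).

Lemma symplectic_adjoint_linear : linear symplectic_adjoint.
Proof.
move=> k u v; apply/funext => i; apply/funext => j; rewrite /symplectic_adjoint.
set c := sgnidx i * sgnidx j; set i' := partner i; set j' := partner j.
change (c * (k * u j' i' + v j' i') = k * (c * u j' i') + c * v j' i' :> F).
by ring.
Qed.

HB.instance Definition _ := GRing.isLinear.Build F (infmx F) (infmx F) *:%R
  symplectic_adjoint symplectic_adjoint_linear.

(** Entry (i, j) of x^t y + y x is, up to sign, entry (i', j) of
    x + y^-1 x^t y. *)
Lemma sp_infE : sp_inf F = skew symplectic_adjoint.
Proof.
have mulxy x i j : mulinf (trinfmx x) (sympl_inf F) i j =
    x (partner j) i * sgnidx (partner j).
  rewrite /mulinf (@fsum_single _ _ (partner j)) => [|k kj].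
    by rewrite sympl_infE partnerK eqxx mulr1.
  by rewrite sympl_infE eq_sym -eq_partner (negbTE kj) !mulr0.
have mulyx x i j : mulinf (sympl_inf F) x i j = sgnidx i * x (partner i) j.
  rewrite /mulinf (@fsum_single _ _ (partner i)) => [|k ki].
    by rewrite sympl_infE eqxx mulr1.
  by rewrite sympl_infE (negbTE ki) mulr0 mul0r.
have spE x i j : mulinf (trinfmx x) (sympl_inf F) i j +
    mulinf (sympl_inf F) x i j =
    sgnidx i * (symplectic_adjoint x (partner i) j + x (partner i) j).
  rewrite mulxy mulyx /symplectic_adjoint !sgnidx_partner partnerK.
  rewrite -[x (partner j) i in LHS]mul1r -(sgnidx_sqr i).
  by ring.
apply/seteqP; split=> x [gx /= tx]; split=> //=;
    apply/funext => i; apply/funext => j.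
  have : (0 : infmx F) (partner i) j = 0 by [].
  rewrite -tx => /eqP; rewrite [X in X == _]spE partnerK mulf_eq0 signr_eq0 /=.
  by rewrite addr_eq0 => /eqP.
by rewrite [LHS]spE tx addNr mulr0.
Qed.

Lemma symplectic_adjoint_mul a b : symplectic_adjoint (mulinf a b) =
  mulinf (symplectic_adjoint b) (symplectic_adjoint a).
Proof.
apply/funext => i; apply/funext => j; rewrite /symplectic_adjoint /mulinf.
rewrite (reindex_fsbigT partner _ (Bijective partnerK partnerK)) /=.
rewrite mulr_fsumr; apply: eq_fsbigr => k _.
transitivity (sgnidx k * sgnidx k * (sgnidx i * sgnidx j *
  (a (partner j) (partner k) * b (partner k) (partner i)))).
  by rewrite sgnidx_sqr mul1r.
by ring.
Qed.

Lemma symplectic_adjoint_munit i j : symplectic_adjoint (munit F i j) =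
  sgnidx i * sgnidx j *: munit F (partner j) (partner i).
Proof.
apply/funext => k; apply/funext => l.
change (sgnidx k * sgnidx l * ((partner l == i) && (partner k == j))%:R =
  sgnidx i * sgnidx j * ((k == partner j) && (l == partner i))%:R).
rewrite !eq_partner andbC; case: eqP => [<-|_]; last by rewrite !mulr0.
case: eqP => [<-|_]; last by rewrite !mulr0.
by rewrite !sgnidx_partner; ring.
Qed.

Let S := lie_product (@brinf F) (eigengrading (sp_inf F) (@diag_der F odd) (-1))
  (eigengrading (sp_inf F) (@diag_der F odd) 1).

(** With i' and j' the partners of i and j, the bracket of e_ij' + e_ji' and
    e_j'j is e_ij - e_j'i', doubled when i = j because then the two terms of
    the first matrix coincide. *)
Lemma sp_even_bracket i j : ~~ odd i -> ~~ odd j ->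
  S (munit F i j - munit F (partner j) (partner i)).
Proof.
move=> ei ej; have sgn1 k : ~~ odd k -> sgnidx k = 1.
  by rewrite /sgnidx => /negbTE ->.
have sS : subspace S by apply: subspace_lspan.
have glS := gl_subspace F.
pose u := munit F i (partner j) + munit F j (partner i).
pose v := munit F (partner j) j.
have -> : munit F i j - munit F (partner j) (partner i) =
    (1 + (i == j)%:R)^-1 *: brinf u v.
  have nz : 1 + (i == j)%:R != 0 :> F.
    by have /GRing.pcharf0P char0 := charF; rewrite -mulrS char0.
  apply: (scalerI nz); rewrite scalerA divff // scale1r.
  apply/funext => p; apply/funext => q; rewrite brinf_munit /u /munit.
  change ((1 + (i == j)%:R) * (((p == i) && (q == j))%:R -
      ((p == partner j) && (q == partner i))%:R) =
    (((p == i) && (partner j == partner j))%:R +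
     ((p == j) && (partner j == partner i))%:R) * (q == j)%:R -
    (p == partner j)%:R * (((j == i) && (q == partner j))%:R +
      ((j == j) && (q == partner i))%:R) :> F).
  rewrite !(inj_eq (can_inj partnerK)) !eqxx [j == i]eq_sym -!mulnb !natrM.
  by case: (i =P j) => [->|_] /=; ring.
apply: (subspaceZ _ sS); apply: lie_product_br.
- apply: eigengradingN1.
    rewrite sp_infE; split; first by apply: subspaceD => //; apply: munit_gl.
    rewrite /= linearD /= !symplectic_adjoint_munit !partnerK !sgnidx_partner.
    by rewrite !sgn1 // mulrN1 !scaleN1r -opprD addrC.
  rewrite /= linearD /= !diag_der_munit !odd_partner (negbTE ei) (negbTE ej) /=.
  by rewrite sub0r !scaleN1r opprD.
- apply: eigengrading1.
    rewrite sp_infE; split; first by apply: munit_gl.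
    rewrite /= symplectic_adjoint_munit partnerK sgnidx_partner !sgn1 //.
    by rewrite mulr1 scaleN1r.
  by rewrite /= diag_der_munit odd_partner (negbTE ej) /= subr0 scale1r.
Qed.

Lemma sp_graded : exists g : int -> set (infmx F),
  three_grading (@brinf F) (sp_inf F) g /\
  g 0 = lie_product (@brinf F) (g (-1)) (g 1).
Proof.
apply: (gl_eigen_grading charF (D := @diag_der F odd)).
- by rewrite sp_infE => x [].
- by rewrite sp_infE; apply: skew_subspace.
- by rewrite sp_infE; apply/skew_brinf/symplectic_adjoint_mul.
- rewrite sp_infE => x [gx /= tx]; split; first exact: diag_der_gl.
  apply/funext => i; apply/funext => j.
  have := congr1 (fun y : infmx F => y i j) tx.
  rewrite /= /symplectic_adjoint /diag_der !odd_partner.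
  change (sgnidx i * sgnidx j * x (partner j) (partner i) = - x i j ->
    sgnidx i * sgnidx j *
      (((~~ odd j)%:R - (~~ odd i)%:R) * x (partner j) (partner i)) =
    - (((odd i)%:R - (odd j)%:R) * x i j)).
  rewrite mulrCA => ->.
  by case: (odd i); case: (odd j) => /=; ring.
- by rewrite sp_infE => a b [ga _] [gb _]; apply: diag_der_brinf.
- by move=> x _; apply: diag_der3.
have sS : subspace S by apply: subspace_lspan.
move=> x spx Dx; have skx : skew symplectic_adjoint x by rewrite -sp_infE.
apply: (skew_span charF sS skx) => i j xij.
have oij : odd i = odd j.
  by apply/eqP; apply: contraNT xij => oij; rewrite (diag_der_eq0 Dx oij).
rewrite /= symplectic_adjoint_munit /sgnidx oij -expr2 sqrr_sign scale1r.
(* For odd indices, e_ij - e_j'i' is the opposite of the same matrix for the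
   even indices j' and i'. *)
have [oj|ej] := boolP (odd j); last by apply: sp_even_bracket; rewrite ?oij.
rewrite -opprB -scaleN1r -{2}[i]partnerK -{2}[j]partnerK.
apply: (subspaceZ _ sS); apply: sp_even_bracket; by rewrite odd_partner ?oij oj.
Qed.

End Symplectic.

(** * The orthogonal algebra *)

Section Orthogonal.
Variables (F : fieldType) (im : F).
Hypothesis charF : [pchar F] =i pred0.
Hypothesis im2 : im * im = -1.
Implicit Types (a b x : infmx F).

Lemma im_neq0 : im != 0.
Proof.
by apply/eqP => im0; move/eqP: im2; rewrite im0 mul0r eq_sym oppr_eq0 oner_eq0.
Qed.

Definition wedge i j : infmx F := munit F i j - munit F j i.

Lemma trinfmx_linear : linear (@trinfmx F).
Proof. by []. Qed.

HB.instance Definition _ :=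
  GRing.isLinear.Build F (infmx F) (infmx F) *:%R (@trinfmx F) trinfmx_linear.

Lemma trinfmx_mul a b : trinfmx (mulinf a b) = mulinf (trinfmx b) (trinfmx a).
Proof.
apply/funext => i; apply/funext => j; rewrite /trinfmx /mulinf.
by apply: eq_fsbigr => k _; rewrite mulrC.
Qed.

Lemma trinfmx_munit i j : trinfmx (munit F i j) = munit F j i.
Proof.
by apply/funext => k; apply/funext => l; rewrite /trinfmx /munit andbC.
Qed.

Lemma o_infE : o_inf F = skew (@trinfmx F).
Proof.
apply/seteqP; split=> x [gx /= tx]; split=> //=; last by rewrite tx addNr.
by apply/eqP; rewrite -addr_eq0 tx.
Qed.

Lemma o_subspace : subspace (o_inf F).
Proof. by rewrite o_infE; apply: skew_subspace. Qed.

Lemma wedge_o i j : o_inf F (wedge i j).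
Proof.
rewrite o_infE; split.
  by apply: subspaceB (gl_subspace F) _ _; apply: munit_gl.
by rewrite /= linearB /= !trinfmx_munit opprB.
Qed.

Lemma brinf_wedge x k l p q : gl_inf F x -> brinf x (wedge k l) p q =
  (x p k * (q == l)%:R - (p == k)%:R * x l q) -
  (x p l * (q == k)%:R - (p == l)%:R * x k q).
Proof.
move=> gx; rewrite /wedge (GRing.zmod_morphism_linear (brinf_linear gx)).
by rewrite -!brinf_munit.
Qed.

(** The factor [im] makes the eigenvalues of [rot] on the plane of the indices
    0 and 1 equal to 1 and -1. *)
Definition rot : infmx F := im *: wedge 0 1.

Lemma rot_o : o_inf F rot.
Proof. exact: (subspaceZ _ o_subspace (wedge_o 0 1)). Qed.

Lemma rot_gl : gl_inf F rot. Proof. by have [] := rot_o. Qed.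

Definition rot_der x : infmx F := brinf rot x.

Lemma rot_der_linear : linear rot_der.
Proof. exact: brinf_linear rot_gl. Qed.

HB.instance Definition _ :=
  GRing.isLinear.Build F (infmx F) (infmx F) *:%R rot_der rot_der_linear.

Lemma rot_derE x p q : gl_inf F x -> rot_der x p q =
  im * ((p == 0%N)%:R * x 1%N q - (p == 1%N)%:R * x 0%N q +
        x p 1%N * (q == 0%N)%:R - x p 0%N * (q == 1%N)%:R).
Proof.
move=> gx; rewrite /rot_der /rot brinfC brinfZr //.
change (- (im * brinf x (wedge 0 1) p q) =
  im * ((p == 0%N)%:R * x 1%N q - (p == 1%N)%:R * x 0%N q +
        x p 1%N * (q == 0%N)%:R - x p 0%N * (q == 1%N)%:R)).
by rewrite brinf_wedge //; ring.
Qed.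

Lemma o_infC x i j : o_inf F x -> x i j = - x j i.
Proof.
by rewrite o_infE => -[_ /(congr1 (fun y : infmx F => y j i))].
Qed.

Lemma o_inf_diag x i : o_inf F x -> x i i = 0.
Proof.
move=> /(@o_infC x i i) /eqP; rewrite -addr_eq0 -mulr2n -mulr_natr mulf_eq0.
by have /GRing.pcharf0P -> := charF; rewrite orbF => /eqP.
Qed.

Lemma o_brinf a b : o_inf F a -> o_inf F b -> o_inf F (brinf a b).
Proof. by rewrite o_infE; apply/skew_brinf/trinfmx_mul. Qed.

(** Let h = [rot]. Then h^3 = h, and for x skew h x h is supported in the plane
    of h, where skew matrices are multiples of h; so h x h commutes with h and
    (ad h)^3 x = h^3 x - x h^3 = (ad h) x. The proof computes entries. *)
Lemma rot_der3 x : o_inf F x -> rot_der (rot_der (rot_der x)) = rot_der x.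
Proof.
move=> ox; have o1 := o_brinf rot_o ox; have o2 := o_brinf rot_o o1.
apply/funext => p; apply/funext => q; have x00 := o_inf_diag 0 ox.
have x11 := o_inf_diag 1 ox; have x10 := o_infC 1 0 ox.
rewrite rot_derE; last by case: o2.
rewrite !(@rot_derE (rot_der x)); try by case: o1.
rewrite !(@rot_derE x); try by case: ox.
case: p => [|[|p]]; case: q => [|[|q]]; rewrite /= ?x00 ?x11 ?x10; ring: im2.
Qed.

(** The wedge product of e_0 + e e_1 with e_i; its first factor is isotropic
    when e^2 = -1. *)
Definition isotropic_wedge (e : F) i : infmx F := wedge 0 i + e *: wedge 1 i.

Lemma isotropic_wedge_o e i : o_inf F (isotropic_wedge e i).
Proof.
apply: (subspaceD o_subspace (wedge_o 0 i)).
exact: (subspaceZ e o_subspace (wedge_o 1 i)).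
Qed.

Lemma isotropic_wedgeE e i p q : isotropic_wedge e i.+2 p q =
  (p == 0%N)%:R * (q == i.+2)%:R - (p == i.+2)%:R * (q == 0%N)%:R +
  e * ((p == 1%N)%:R * (q == i.+2)%:R - (p == i.+2)%:R * (q == 1%N)%:R) :> F.
Proof. by rewrite -!natrM !mulnb. Qed.

(** As e^2 = -1, [rot] maps e_0 + e e_1 to im (e e_0 - e_1), that is, to
    e im (e_0 + e e_1), and it kills e_i for i > 1. *)
Lemma rot_der_isotropic (e : F) i : e * e = -1 ->
  rot_der (isotropic_wedge e i.+2) = (e * im) *: isotropic_wedge e i.+2.
Proof.
move=> e2; apply/funext => p; apply/funext => q.
rewrite rot_derE; last by case: (isotropic_wedge_o e i.+2).
change (im * ((p == 0%N)%:R * isotropic_wedge e i.+2 1%N q -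
    (p == 1%N)%:R * isotropic_wedge e i.+2 0%N q +
    isotropic_wedge e i.+2 p 1%N * (q == 0%N)%:R -
    isotropic_wedge e i.+2 p 0%N * (q == 1%N)%:R) =
  e * im * isotropic_wedge e i.+2 p q).
rewrite !isotropic_wedgeE.
by case: p => [|[|p]]; case: q => [|[|q]]; rewrite /=; ring: e2.
Qed.

(** If u and v are orthogonal to p and q, then [p /\ u, q /\ v] is
    - (u.v) (p /\ q) - (p.q) (u /\ v). Here p and q are e_0 + im e_1 and
    e_0 - im e_1, so that p.q = 2 and p /\ q = - 2 im (e_0 /\ e_1). *)
Lemma isotropic_wedge_bracket i j :
  brinf (isotropic_wedge im i.+2) (isotropic_wedge (- im) j.+2) =
  (2%:R * im * (i == j)%:R) *: wedge 0 1 - 2%:R *: wedge i.+2 j.+2.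
Proof.
have gu : gl_inf F (isotropic_wedge im i.+2).
  by case: (isotropic_wedge_o im i.+2).
rewrite [isotropic_wedge (- im) _]addrC (brinf_linear gu).
apply/funext => p; apply/funext => q.
change (- im * brinf (isotropic_wedge im i.+2) (wedge 1 j.+2) p q +
    brinf (isotropic_wedge im i.+2) (wedge 0 j.+2) p q =
  2%:R * im * (i == j)%:R *
    (((p == 0%N) && (q == 1%N))%:R - ((p == 1%N) && (q == 0%N))%:R) -
  2%:R * (((p == i.+2) && (q == j.+2))%:R - ((p == j.+2) && (q == i.+2))%:R)).
rewrite !brinf_wedge // !isotropic_wedgeE -!mulnb !natrM !eqxx !eqSS.
rewrite [j == i]eq_sym /=.
(* The indicators become variables, so that no identity between indices is
   tried by the polynomial normalization. *)
move: ((p == 0%N)%:R : F) ((p == 1%N)%:R : F) ((p == i.+2)%:R : F).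
move: ((p == j.+2)%:R : F) ((q == 0%N)%:R : F) ((q == 1%N)%:R : F).
move: ((q == i.+2)%:R : F) ((q == j.+2)%:R : F) ((i == j)%:R : F) => *.
by ring: im2.
Qed.

Let g := eigengrading (o_inf F) rot_der.
Let S := lie_product (@brinf F) (g (-1)) (g 1).

Lemma lie_product_isotropic i j :
  S (brinf (isotropic_wedge im i.+2) (isotropic_wedge (- im) j.+2)).
Proof.
apply: lie_product_br.
- apply: eigengradingN1; first exact: isotropic_wedge_o.
  by rewrite /= rot_der_isotropic // im2 scaleN1r.
- apply: eigengrading1; first exact: isotropic_wedge_o.
  by rewrite /= rot_der_isotropic ?mulrNN // mulNr im2 opprK scale1r.
Qed.

(** The case i = j of [isotropic_wedge_bracket], where the second wedge product
    vanishes. *)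
Lemma lie_product_wedge01 : S (wedge 0 1).
Proof.
have sS : subspace S by apply: subspace_lspan.
have nz : 2%:R * im != 0.
  by rewrite mulf_neq0 ?im_neq0 //; have /GRing.pcharf0P -> := charF.
have := subspaceZ (2%:R * im)^-1 sS (lie_product_isotropic 0 0).
rewrite isotropic_wedge_bracket [wedge 2 2]subrr scaler0 subr0 mulr1.
by rewrite scalerA mulVf ?scale1r.
Qed.

Lemma lie_product_wedge i j : S (wedge i.+2 j.+2).
Proof.
have sS : subspace S by apply: subspace_lspan.
have two0 : (2%:R : F) != 0 by have /GRing.pcharf0P -> := charF.
have := subspaceB sS
  (subspaceZ (2%:R * im * (i == j)%:R) sS lie_product_wedge01)
  (lie_product_isotropic i j).
rewrite isotropic_wedge_bracket opprB addrCA subrr addr0 => S2.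
by have := subspaceZ 2%:R^-1 sS S2; rewrite scalerA mulVf ?scale1r.
Qed.

Lemma o_graded : exists g : int -> set (infmx F),
  three_grading (@brinf F) (o_inf F) g /\
  g 0 = lie_product (@brinf F) (g (-1)) (g 1).
Proof.
apply: (gl_eigen_grading charF (D := rot_der)).
- by move=> x [].
- exact: o_subspace.
- exact: o_brinf.
- by move=> x; apply: o_brinf; apply: rot_o.
- by move=> a b [ga _] [gb _]; apply: brinf_derivation => //; apply: rot_gl.
- exact: rot_der3.
have sS : subspace S by apply: subspace_lspan.
move=> x ox Dx; have skx : skew (@trinfmx F) x by rewrite -o_infE.
(* Entry (0, j) of D x is im x_1j and entry (1, j) is - im x_0j, for j > 1. *)
have x0 j : x 0%N j.+2 = 0 /\ x 1%N j.+2 = 0.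
  have := congr1 (fun y : infmx F => y 0%N j.+2) Dx.
  have := congr1 (fun y : infmx F => y 1%N j.+2) Dx.
  change (rot_der x 1%N j.+2 = 0 -> rot_der x 0%N j.+2 = 0 ->
    x 0%N j.+2 = 0 /\ x 1%N j.+2 = 0).
  have gx : gl_inf F x by case: ox.
  rewrite !rot_derE //= !mulr0 !mul0r !mul1r !subr0 !addr0 sub0r.
  move=> /eqP + /eqP; rewrite !mulf_eq0 (negbTE im_neq0) /= oppr_eq0.
  by move=> /eqP -> /eqP ->.
apply: (skew_span charF sS skx) => i j; rewrite /= trinfmx_munit -/(wedge i j).
have ww k : S (wedge k k) by rewrite /wedge subrr; case/subspaceP: sS.
case: i => [|[|i]]; case: j => [|[|j]] xij.
- exact: ww.
- exact: lie_product_wedge01.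
- by case: (x0 j) xij => ->; rewrite eqxx.
- rewrite /wedge -opprB -scaleN1r.
  exact: (subspaceZ _ sS lie_product_wedge01).
- exact: ww.
- by case: (x0 j) xij => _ ->; rewrite eqxx.
- rewrite (o_infC _ _ ox) in xij.
  by case: (x0 i) xij => -> _; rewrite oppr0 eqxx.
- rewrite (o_infC _ _ ox) in xij.
  by case: (x0 i) xij => _ ->; rewrite oppr0 eqxx.
- exact: lie_product_wedge.
Qed.

End Orthogonal.

(** * The three gradings *)

Lemma closed_sqrtN1 (F : closedFieldType) : exists im : F, im * im = -1.
Proof.
have [im] := @solve_monicpoly F 2 (fun i => if i == 0%N then -1 else 0) isT.
rewrite !big_ord_recr big_ord0 /= expr0 mulr1 mul0r add0r addr0 => im2.
by exists im; rewrite -expr2.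
Qed.

Theorem proposition4p1 (F : closedFieldType) (charF : [pchar F] =i pred0) :
  forall L : set (infmx F), L = sl_inf F \/ L = o_inf F \/ L = sp_inf F ->
  exists g : int -> set (infmx F),
    three_grading (@brinf F) L g /\
    g 0 = lie_product (@brinf F) (g (-1)) (g 1).
Proof.
have [im im2] := closed_sqrtN1 F.
move=> L [->|[->|->]].
- exact: sl_graded.
- exact: o_graded im2.
- exact: sp_graded.
Qed.
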